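(* In the two-block setting, suppose Assumptions 1 and 2 hold. Let $\{y^{k+1},s^{k+1},x^{k+1}\}_{k\ge0}$ be generated by Algorithm B from $y^0\in\operatorname{dom}f_1$, $x^0\in\mathbb{X}$, $\sigma>0$, and let $(y^*,s^*,x^* )$ be its limit. Then for all $k\ge0$, $$\|\mathcal{R}(y^{k+1},s^{k+1},x^{k+1})\|\le\frac{1}{k+1}\Big(\frac{\sigma\|B_2^*\|+1}{\sigma}\big(\|x^0-x^*\|+\sigma\|B_1y^0-B_1y^*\|\big)\Big),$$ $$h(y^{k+1},s^{k+1})\ge-\frac{1}{k+1}\Big(\frac{\|x^*\|}{\sigma}\big(\|x^0-x^*\|+\sigma\|B_1y^0-B_1y^*\|\big)\Big),$$ $$h(y^{k+1},s^{k+1})\le\frac{1}{k+1}\cdot\frac{\big(\|x^0-x^*\|+\sigma\|B_1y^0-B_1y^*\|\big)^2+\|x^*\|\big(\|x^0-x^*\|+\sigma\|B_1y^0-B_1y^*\|\big)}{\sigma}.$$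
   Context: Two-block setting: $\mathbb{X},\mathbb{Y},\mathbb{Z}$ are finite-dimensional real Euclidean spaces; $f_1:\mathbb{Y}\to(-\infty,+\infty]$, $f_2:\mathbb{Z}\to(-\infty,+\infty]$ proper closed convex; $B_1:\mathbb{Y}\to\mathbb{X}$, $B_2:\mathbb{Z}\to\mathbb{X}$ linear; $c\in\mathbb{X}$. Problem (P): $\min f_1(y)+f_2(s)$ s.t. $B_1y+B_2s=c$. Dual (D): $\max_x\{-f_1^*(-B_1^*x)-f_2^*(-B_2^*x)-\langle c,x\rangle\}$. $L_\sigma(y,s;x):=f_1(y)+f_2(s)+\langle x,B_1y+B_2s-c\rangle+\frac{\sigma}{2}\|B_1y+B_2s-c\|^2$. $\Sigma_{f_1}$ (resp. $\Sigma_{f_2}$) is a self-adjoint positive semidefinite operator with $f_1(y)\ge f_1(\hat y)+\langle\hat\phi,y-\hat y\rangle+\frac12\|y-\hat y\|^2_{\Sigma_{f_1}}$ and $\langle\phi-\hat\phi,y-\hat y\rangle\ge\|y-\hat y\|^2_{\Sigma_{f_1}}$ for all $y,\hat y\in\operatorname{dom}f_1$, $\phi\in\partial f_1(y)$, $\hat\phi\in\partial f_1(\hat y)$ (same for $f_2$). Assumption 1: for $i=1,2$, $\operatorname{ri}(\operatorname{dom}f_i^* )\cap\operatorname{Range}(B_i^* )\ne\emptyset$; $\operatorname{ri}(\operatorname{dom}(f_1^*\circ(-B_1^* )))\cap\operatorname{ri}(\operatorname{dom}(f_2^*\circ(-B_2^* )))\ne\emptyset$; (P) has a solution. Assumption 2: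 $\Sigma_{f_1}+B_1^*B_1$ and $\Sigma_{f_2}+B_2^*B_2$ are positive definite. Algorithm B: input $y^0,x^0,\sigma$; $\hat x^0:=x^0$; for $k\ge0$: $s^{k+1}=\arg\min_s L_\sigma(y^k,s;\hat x^k)$; $x^{k+1/2}=\hat x^k+\sigma(B_1y^k+B_2s^{k+1}-c)$; $y^{k+1}=\arg\min_y L_\sigma(y,s^{k+1};x^{k+1/2})$; $x^{k+1}=x^{k+1/2}+\sigma(B_1y^{k+1}+B_2s^{k+1}-c)$; $\hat x^{k+1}=\frac{1}{k+2}\hat x^0+\frac{k+1}{k+2}x^{k+1}+\frac{\sigma}{k+2}[(B_1y^0-c)-(B_1y^{k+1}-c)]$. The sequence converges to $(y^*,s^*,x^* )$ with $(y^*,s^* )$ solving (P), $x^*$ solving (D). KKT residual: $\mathcal{R}(y,s,x):=\big(y-\operatorname{Prox}_{f_1}(y-B_1^*x);\ s-\operatorname{Prox}_{f_2}(s-B_2^*x);\ c-B_1y-B_2s\big)$, where $\operatorname{Prox}_f(z):=\arg\min_u\{f(u)+\frac12\|u-z\|^2\}$. $h(y,s):=f_1(y)+f_2(s)-f_1(y^* )-f_2(s^* )$. $\|B_2^*\|$ is the operator (spectral) norm. *)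

(* Defs.v *)
(* Euclidean spaces are modelled as row
   vectors 'rV[R]_n with the standard inner product; a linear map
   B : R^m -> R^n is the matrix B : 'M_(m,n) acting by y |-> y *m B, and its
   adjoint is x |-> x *m B^T. *)
From HB Require Import structures.
From mathcomp Require Import all_boot all_order all_algebra.
From mathcomp Require Import all_classical all_reals all_analysis.
Set Implicit Arguments. Unset Strict Implicit. Unset Printing Implicit Defensive.
Import Order.TTheory GRing.Theory Num.Theory.
Import numFieldNormedType.Exports.
Local Open Scope classical_set_scope.
Local Open Scope ring_scope.

Section Defs.
Variable R : realType.

Definition ip (n : nat) (u v : 'rV[R]_n) : R := \sum_(i < n) u ord0 i * v ord0 i.
Definition enorm (n : nat) (u : 'rV[R]_n) : R := Num.sqrt (ip u u).

Definition opnorm (n m : nat) (A : 'M[R]_(n, m)) : R :=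
  sup [set enorm (v *m A) | v in [set v : 'rV[R]_n | enorm v <= 1]].

Definition edom (n : nat) (f : 'rV[R]_n -> \bar R) : set 'rV[R]_n :=
  [set x | (f x < +oo)%E].

Definition proper_fun (n : nat) (f : 'rV[R]_n -> \bar R) : Prop :=
  (forall x, f x != -oo%E) /\ (exists x, (f x < +oo)%E).

Definition convex_fun (n : nat) (f : 'rV[R]_n -> \bar R) : Prop :=
  forall x y : 'rV[R]_n, forall t : R, 0 <= t -> t <= 1 ->
    (f (t *: x + (1 - t) *: y)%R <= t%:E * f x + (1 - t)%:E * f y)%E.

(* closed = lower semicontinuous = all sublevel sets closed *)
Definition closed_fun (n : nat) (f : 'rV[R]_n -> \bar R) : Prop :=
  forall a : R, closed [set x | (f x <= a%:E)%E].

Definition pcc (n : nat) (f : 'rV[R]_n -> \bar R) : Prop :=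
  [/\ proper_fun f, convex_fun f & closed_fun f].

Definition conj_fun (n : nat) (f : 'rV[R]_n -> \bar R) : 'rV[R]_n -> \bar R :=
  fun z => ereal_sup [set ((ip z u)%:E - f u)%E | u in [set: 'rV[R]_n]].

Definition subdiff (n : nat) (f : 'rV[R]_n -> \bar R) (y : 'rV[R]_n)
  : set 'rV[R]_n :=
  [set phi | f y \is a fin_num /\
             forall u, (f y + (ip phi (u - y))%:E <= f u)%E].

Definition aff_hull (n : nat) (C : set 'rV[R]_n) : set 'rV[R]_n :=
  [set x | exists (k : nat) (pts : 'I_k -> 'rV[R]_n) (w : 'I_k -> R),
      [/\ forall i, C (pts i), \sum_(i < k) w i = 1 &
          x = \sum_(i < k) w i *: pts i]].

Definition rel_int (n : nat) (C : set 'rV[R]_n) : set 'rV[R]_n :=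
  [set x | C x /\ exists2 e : R, 0 < e &
             forall y, aff_hull C y -> enorm (y - x) < e -> C y].

(* proximal mapping (argmin; well defined for proper closed convex f) *)
Definition prox (n : nat) (f : 'rV[R]_n -> \bar R) (z : 'rV[R]_n) : 'rV[R]_n :=
  xget 0 [set u | forall v,
    (f u + (enorm (u - z) ^+ 2 / 2)%:E <= f v + (enorm (v - z) ^+ 2 / 2)%:E)%E].

Definition psd (m : nat) (S : 'M[R]_m) : Prop :=
  S^T = S /\ forall v : 'rV[R]_m, 0 <= ip (v *m S) v.
Definition posdef (m : nat) (S : 'M[R]_m) : Prop :=
  S^T = S /\ forall v : 'rV[R]_m, v != 0 -> 0 < ip (v *m S) v.

Definition sigma_op (m : nat) (f : 'rV[R]_m -> \bar R) (S : 'M[R]_m) : Prop :=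
  psd S /\
  (forall y yh phih, edom f y -> edom f yh -> subdiff f yh phih ->
     (f yh + (ip phih (y - yh) + ip ((y - yh) *m S) (y - yh) / 2)%:E <= f y)%E) /\
  (forall y yh phi phih, edom f y -> edom f yh ->
     subdiff f y phi -> subdiff f yh phih ->
     ip ((y - yh) *m S) (y - yh) <= ip (phi - phih) (y - yh)).

Section TwoBlock.
Variables (n m p : nat).
Variables (f1 : 'rV[R]_m -> \bar R) (f2 : 'rV[R]_p -> \bar R).
Variables (B1 : 'M[R]_(m, n)) (B2 : 'M[R]_(p, n)) (c : 'rV[R]_n).

Definition aug_lag (sigma : R) (y : 'rV[R]_m) (s : 'rV[R]_p) (x : 'rV[R]_n)
  : \bar R :=
  (f1 y + f2 s +
   (ip x (y *m B1 + s *m B2 - c)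
    + sigma / 2 * enorm (y *m B1 + s *m B2 - c) ^+ 2)%:E)%E.

Definition solves_P (y : 'rV[R]_m) (s : 'rV[R]_p) : Prop :=
  [/\ y *m B1 + s *m B2 = c, (f1 y + f2 s < +oo)%E &
      forall y' s', y' *m B1 + s' *m B2 = c -> (f1 y + f2 s <= f1 y' + f2 s')%E].

Definition dual_obj (x : 'rV[R]_n) : \bar R :=
  (- conj_fun f1 (- (x *m B1^T)) - conj_fun f2 (- (x *m B2^T)) - (ip c x)%:E)%E.

Definition solves_D (x : 'rV[R]_n) : Prop :=
  dual_obj x \is a fin_num /\ forall x', (dual_obj x' <= dual_obj x)%E.

Definition assumption1 : Prop :=
  [/\ (exists x : 'rV[R]_n, rel_int (edom (conj_fun f1)) (x *m B1^T)),
      (exists x : 'rV[R]_n, rel_int (edom (conj_fun f2)) (x *m B2^T)),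
      (exists x : 'rV[R]_n,
         rel_int (edom (fun z => conj_fun f1 (- (z *m B1^T)))) x /\
         rel_int (edom (fun z => conj_fun f2 (- (z *m B2^T)))) x) &
      exists y s, solves_P y s].

Definition kkt_res_norm (y : 'rV[R]_m) (s : 'rV[R]_p) (x : 'rV[R]_n) : R :=
  Num.sqrt (enorm (y - prox f1 (y - x *m B1^T)) ^+ 2
          + enorm (s - prox f2 (s - x *m B2^T)) ^+ 2
          + enorm (c - y *m B1 - s *m B2) ^+ 2).

Definition hgap (ys : 'rV[R]_m) (ss : 'rV[R]_p) (y : 'rV[R]_m) (s : 'rV[R]_p)
  : \bar R := (f1 y + f2 s - f1 ys - f2 ss)%E.

(* sequences generated by Algorithm B; s 0 is unused (s^{k+1} for k >= 0) *)
Definition algorithmB (sigma : R) (y : nat -> 'rV[R]_m) (s : nat -> 'rV[R]_p)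
  (x xhat xhalf : nat -> 'rV[R]_n) : Prop :=
  xhat 0%N = x 0%N /\
  [/\ forall k, forall s', (aug_lag sigma (y k) (s k.+1) (xhat k)
                            <= aug_lag sigma (y k) s' (xhat k))%E,
      forall k, xhalf k = xhat k + sigma *: (y k *m B1 + s k.+1 *m B2 - c),
      forall k, forall y', (aug_lag sigma (y k.+1) (s k.+1) (xhalf k)
                            <= aug_lag sigma y' (s k.+1) (xhalf k))%E,
      forall k, x k.+1 = xhalf k + sigma *: (y k.+1 *m B1 + s k.+1 *m B2 - c) &
      forall k, xhat k.+1 = (k.+2%:R)^-1 *: xhat 0%N
                            + (k.+1%:R / k.+2%:R) *: x k.+1
                            + (sigma / k.+2%:R) *:
                                ((y 0%N *m B1 - c) - (y k.+1 *m B1 - c))].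

End TwoBlock.
End Defs.

(* Main.v *)
(* With eta_k = xhat_k + sigma (B1 y_k - c), Algorithm B is the Halpern iteration
   eta_{k+1} = (eta_0 + (k+1) T eta_k) / (k+2) of the Peaceman-Rachford map
   T = id - 2 G, G firmly nonexpansive, and the feasibility residual
   r = B1 y + B2 s - c satisfies G eta_k = - sigma r.  The Lyapunov inequality
   k |G eta_k|^2 <= <G eta_k, eta_0 - eta_k> gives
   sigma |r| <= |eta_0 - eta_star| / (k+1), where eta_star, built from the limit,
   is a fixed point of T because subdifferentials have closed graphs.  The
   subproblems give - B1^* x_{k+1} in df_1(y_{k+1}) and
   - B2^* x_{k+1/2} in df_2(s_{k+1}); since x_{k+1} - x_{k+1/2} = sigma r, all
   three bounds reduce to the bound on r. *)
Require Import Defs.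
From HB Require Import structures.
From mathcomp Require Import all_boot all_order all_algebra.
From mathcomp Require Import all_classical all_reals all_analysis.
From mathcomp Require Import ring lra.
Import Order.TTheory GRing.Theory Num.Theory.
Import numFieldNormedType.Exports.
Local Open Scope classical_set_scope.
Local Open Scope ring_scope.

(** * Euclidean inner product, norm and operator norm *)

Section InnerProduct.
Local Set Implicit Arguments.
Local Unset Strict Implicit.
Context {R : realType}.
Implicit Types n m : nat.

Lemma ipE n (u v : 'rV[R]_n) : ip u v = (u *m v^T) ord0 ord0.
Proof. by rewrite mxE; apply: eq_bigr => i _; rewrite mxE. Qed.

Lemma ipC n (u v : 'rV[R]_n) : ip u v = ip v u.
Proof. by apply: eq_bigr => i _; rewrite mulrC. Qed.

Lemma ipDl n (u v w : 'rV[R]_n) : ip (u + v) w = ip u w + ip v w.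
Proof. by rewrite !ipE mulmxDl mxE. Qed.

Lemma ipZl n a (u v : 'rV[R]_n) : ip (a *: u) v = a * ip u v.
Proof. by rewrite !ipE -scalemxAl mxE. Qed.

Lemma ipNl n (u v : 'rV[R]_n) : ip (- u) v = - ip u v.
Proof. by rewrite !ipE mulNmx mxE. Qed.

Lemma ipDr n (u v w : 'rV[R]_n) : ip w (u + v) = ip w u + ip w v.
Proof. by rewrite ipC ipDl !(ipC w). Qed.

Lemma ipZr n a (u v : 'rV[R]_n) : ip v (a *: u) = a * ip v u.
Proof. by rewrite ipC ipZl (ipC v). Qed.

Lemma ipNr n (u v : 'rV[R]_n) : ip v (- u) = - ip v u.
Proof. by rewrite ipC ipNl (ipC v). Qed.

Lemma ip0l n (v : 'rV[R]_n) : ip 0 v = 0.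
Proof. by rewrite ipE mul0mx mxE. Qed.

Definition ip_lin := (@ipDl, @ipDr, @ipNl, @ipNr, @ipZl, @ipZr).

Lemma ip_adj n m (u : 'rV[R]_n) (v : 'rV[R]_m) (A : 'M[R]_(n, m)) :
  ip (u *m A) v = ip u (v *m A^T).
Proof. by rewrite !ipE trmx_mul trmxK mulmxA. Qed.

Lemma ip_ge0 n (u : 'rV[R]_n) : 0 <= ip u u.
Proof. by apply: sumr_ge0 => i _; rewrite -expr2 sqr_ge0. Qed.

Lemma enorm_ge0 n (u : 'rV[R]_n) : 0 <= enorm u.
Proof. exact: sqrtr_ge0. Qed.

Lemma enorm0 n : enorm (0 : 'rV[R]_n) = 0.
Proof. by rewrite /enorm ip0l sqrtr0. Qed.

Lemma enorm_sqr n (u : 'rV[R]_n) : enorm u ^+ 2 = ip u u.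
Proof. by rewrite sqr_sqrtr// ip_ge0. Qed.

Lemma enorm_le n (u : 'rV[R]_n) a : 0 <= a -> ip u u <= a ^+ 2 -> enorm u <= a.
Proof. by move=> a0; rewrite -enorm_sqr ler_sqr ?nnegrE ?enorm_ge0. Qed.

Lemma enormZ n a (u : 'rV[R]_n) : enorm (a *: u) = `|a| * enorm u.
Proof. by rewrite /enorm ipZl ipZr mulrA -expr2 sqrtrM ?sqr_ge0// sqrtr_sqr. Qed.

Lemma enormN n (u : 'rV[R]_n) : enorm (- u) = enorm u.
Proof. by rewrite -scaleN1r enormZ normrN1 mul1r. Qed.

(** Bridge between the Euclidean norm and the coordinatewise topology in which limits are taken. *)
Lemma normr_coord_le n (u : 'rV[R]_n) i : `|u ord0 i| <= enorm u.
Proof.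
rewrite -sqrtr_sqr ler_wsqrtr// expr2 /ip (bigD1 i)//= lerDl.
by apply: sumr_ge0 => j _; rewrite -expr2 sqr_ge0.
Qed.

Lemma enorm0_eq0 n (u : 'rV[R]_n) : enorm u = 0 -> u = 0.
Proof.
move=> u0; apply/rowP => i; rewrite mxE; apply/eqP.
by rewrite -normr_le0 -u0 normr_coord_le.
Qed.

Lemma ip_le_enorm n (u v : 'rV[R]_n) : ip u v <= enorm u * enorm v.
Proof.
have [u0|u0] := eqVneq (enorm u) 0.
  by rewrite (enorm0_eq0 u0) ip0l enorm0 mul0r.
have [v0|v0] := eqVneq (enorm v) 0.
  by rewrite (enorm0_eq0 v0) ipC ip0l enorm0 mulr0.
have up : 0 < enorm u by rewrite lt_def u0 enorm_ge0.
have vp : 0 < enorm v by rewrite lt_def v0 enorm_ge0.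
(* Cauchy-Schwarz is the expansion of this square, divided by 2|u||v|. *)
have := ip_ge0 (enorm v *: u - enorm u *: v).
rewrite !ip_lin -!enorm_sqr (ipC v u) => h.
rewrite -subr_ge0 -(pmulr_rge0 _ (mulr_gt0 up vp)); nra.
Qed.

Lemma enormD n (u v : 'rV[R]_n) : enorm (u + v) <= enorm u + enorm v.
Proof.
apply: enorm_le; first by rewrite addr_ge0 ?enorm_ge0.
rewrite !ip_lin -!enorm_sqr (ipC v u); have := ip_le_enorm u v; lra.
Qed.

(** Makes the supremum in [opnorm] a genuine one. The bound [K] is the Frobenius norm, obtained from
    Cauchy-Schwarz on each column. *)
Lemma opnorm_has_ubound n m (A : 'M[R]_(n, m)) :
  has_ubound [set enorm (v *m A) | v in [set v : 'rV[R]_n | enorm v <= 1]].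
Proof.
pose K := Num.sqrt (\sum_(j < m) enorm (col j A)^T ^+ 2).
have K_ge0 : 0 <= \sum_(j < m) enorm (col j A)^T ^+ 2.
  by apply: sumr_ge0 => j _; rewrite sqr_ge0.
have bnd w : enorm (w *m A) <= K * enorm w.
  apply: enorm_le; first by rewrite mulr_ge0 ?sqrtr_ge0 ?enorm_ge0.
  rewrite exprMn sqr_sqrtr// mulr_suml; apply: ler_sum => j _.
  have -> : (w *m A) ord0 j = ip w (col j A)^T.
    by rewrite mxE; apply: eq_bigr => i _; rewrite !mxE.
  rewrite -expr2 mulrC -exprMn -[X in X <= _]real_normK ?num_real//.
  rewrite ler_sqr ?nnegrE ?mulr_ge0 ?enorm_ge0// ler_norml ip_le_enorm andbT.
  by rewrite lerNl -ipNl -[enorm w]enormN ip_le_enorm.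
exists K => _ [w /= w1 <-]; apply: (le_trans (bnd w)).
by rewrite ler_piMr ?sqrtr_ge0.
Qed.

Lemma opnorm_ge0 n m (A : 'M[R]_(n, m)) : 0 <= opnorm A.
Proof.
apply: ub_le_sup; first exact: opnorm_has_ubound.
by exists 0; rewrite /= ?mul0mx enorm0.
Qed.

Lemma opnorm_le n m (A : 'M[R]_(n, m)) v : enorm (v *m A) <= opnorm A * enorm v.
Proof.
have [v0|v0] := eqVneq (enorm v) 0.
  by rewrite (enorm0_eq0 v0) mul0mx !enorm0 mulr0.
have vp : 0 < enorm v by rewrite lt_def v0 enorm_ge0.
have nv : enorm ((enorm v)^-1 *: v) = 1.
  by rewrite enormZ ger0_norm ?invr_ge0 ?enorm_ge0// mulVf.
rewrite -ler_pdivrMr// mulrC -[X in X * _]ger0_norm ?invr_ge0 ?enorm_ge0//.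
rewrite -enormZ scalemxAl; apply: ub_le_sup; first exact: opnorm_has_ubound.
by exists ((enorm v)^-1 *: v); rewrite /= ?nv.
Qed.

End InnerProduct.

(* [e k.+1] is the Halpern average of [e 0] and [T (e k)], where
   [T = id - 2 G] with [G] firmly nonexpansive along the iterates. *)
Section Halpern.
Local Set Implicit Arguments.
Local Unset Strict Implicit.
Context {R : realType} {n : nat}.
Variables (e G : nat -> 'rV[R]_n) (es : 'rV[R]_n).
Hypothesis rec : forall k, e k.+1 =
  (k.+2%:R)^-1 *: e 0%N + (k.+1%:R / k.+2%:R) *: (e k - 2 *: G k).
Hypothesis firm : forall k,
  ip (G k.+1 - G k) (G k.+1 - G k) <= ip (G k.+1 - G k) (e k.+1 - e k).
Hypothesis firm_fix : forall k, ip (G k) (G k) <= ip (G k) (e k - es).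

(** Write a = [G k], b = [G k.+1], d = [e 0 - e k]. Adding (k+2) times [firm] to the induction
    hypothesis gives exactly (k+2)|b|^2 <= <b, d + 2a>, and [e 0 - e k.+1] is (k+1)/(k+2) times d +
    2a. *)
Lemma halpern_lyapunov k : k%:R * ip (G k) (G k) <= ip (G k) (e 0%N - e k).
Proof.
elim: k => [|k IH]; first by rewrite mul0r subrr ipC ip0l.
have := firm k; have := IH.
have -> : e k.+1 = e 0%N - (k.+1%:R / k.+2%:R) *: (e 0%N - e k + 2 *: G k).
  rewrite rec; apply/rowP => i; rewrite !mxE; field.
  by rewrite -(natrD _ 2) pnatr_eq0.
set d := e 0%N - e k; set a := G k; set b := G k.+1.
have -> : e 0%N - (k.+1%:R / k.+2%:R) *: (d + 2 *: a) - e k =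
   k.+2%:R^-1 *: (d - (2 * k.+1%:R) *: a).
  rewrite /d; apply/rowP => i; rewrite !mxE; field.
  by rewrite -(natrD _ 2) pnatr_eq0.
rewrite ipZr.
have -> : e 0%N - (e 0%N - (k.+1%:R / k.+2%:R) *: (d + 2 *: a)) =
  (k.+1%:R / k.+2%:R) *: (d + 2 *: a) by rewrite opprB addrCA subrr addr0.
have k2 : 0 < k.+2%:R :> R by [].
have k1 : 0 <= k.+1%:R :> R by [].
move=> h0; rewrite mulrC ler_pdivlMr// => h1.
rewrite ipZr mulrAC -mulrA ler_wpM2l// ler_pdivlMr//.
move: h0 h1; rewrite !ip_lin (ipC b a) -(natr1 k) -(natr1 k.+1) -(natr1 k); nra.
Qed.

(** Adding [firm_fix] to the Lyapunov inequality raises k to k+1 and replaces [e k] by [es];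
    Cauchy-Schwarz then cancels one factor |G k|. *)
Lemma halpern_residual k : k.+1%:R * enorm (G k) <= enorm (e 0%N - es).
Proof.
have [g0|g0] := eqVneq (enorm (G k)) 0; first by rewrite g0 mulr0 enorm_ge0.
have gp : 0 < enorm (G k) by rewrite lt_def g0 enorm_ge0.
rewrite -(ler_pM2r gp) -mulrA -expr2 enorm_sqr.
apply: (@le_trans _ _ (ip (e 0%N - es) (G k))); last exact: ip_le_enorm.
have := firm_fix k; have := halpern_lyapunov k.
rewrite (ipC (e 0%N - es)) !ip_lin -(natr1 k); lra.
Qed.

(** By [firm_fix], moving from [e k] to [e k - 2 G k] does not increase the distance to [es], and
    balls around [es] are convex. *)
Lemma halpern_bounded k : enorm (e k - es) <= enorm (e 0%N - es).
Proof.
elim: k => // k IH.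
have k2 : k.+2%:R != 0 :> R by rewrite pnatr_eq0.
have -> : e k.+1 - es = (k.+2%:R)^-1 *: (e 0%N - es)
    + (k.+1%:R / k.+2%:R) *: (e k - es - 2 *: G k).
  rewrite rec; apply/rowP => i; rewrite !mxE; field.
  by rewrite -(natrD _ 2) pnatr_eq0.
have h : enorm (e k - es - 2 *: G k) <= enorm (e 0%N - es).
  apply: le_trans IH; apply: enorm_le; first exact: enorm_ge0.
  move: (firm_fix k); move: (e k - es) => w.
  rewrite enorm_sqr !ip_lin (ipC w (G k)); lra.
apply: (le_trans (enormD _ _)).
rewrite !enormZ !ger0_norm ?divr_ge0 ?invr_ge0//.
set N := enorm (e 0%N - es) in h *.
rewrite -[leRHS](_ : k.+2%:R^-1 * N + k.+1%:R / k.+2%:R * N = N); last first.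
  by field; rewrite -(natrD _ 2) pnatr_eq0.
by rewrite lerD2l ler_wpM2l// divr_ge0.
Qed.

End Halpern.

(** * Limits of row vectors, reduced to coordinates *)

Section Convergence.
Context {R : realType}.
Local Set Implicit Arguments.
Local Unset Strict Implicit.
Implicit Types n m : nat.

Lemma cvg_coord n (u : nat -> 'rV[R]_n) (a : 'rV[R]_n) i :
  u @ \oo --> a -> u k ord0 i @[k --> \oo] --> a ord0 i.
Proof.
by move=> ua; apply: (cvg_comp u (fun v : 'rV[R]_n => v ord0 i) ua);
  exact: coord_continuous.
Qed.

Lemma cvg_rV n (u : nat -> 'rV[R]_n) (a : 'rV[R]_n) :
  (forall i, u k ord0 i @[k --> \oo] --> a ord0 i) -> u @ \oo --> a.
Proof.
move=> ua; apply/cvg_ballP => e e0.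
have h : \forall k \near \oo, forall i, ball (a ord0 i) e (u k ord0 i).
  by apply: filter_forall => i; exact: (cvg_ball (ua i)).
by apply: filterS h => k h; split=> // i j; rewrite (ord1 i).
Qed.

Lemma cvg_ip n (u v : nat -> 'rV[R]_n) (a b : 'rV[R]_n) :
  u @ \oo --> a -> v @ \oo --> b -> ip (u k) (v k) @[k --> \oo] --> ip a b.
Proof.
move=> ua vb; apply: cvg_big => [|i _]; first exact: add_continuous.
by apply: cvgM; exact: cvg_coord.
Qed.

Lemma cvg_mulmxr n m (u : nat -> 'rV[R]_n) (a : 'rV[R]_n) (B : 'M[R]_(n, m)) :
  u @ \oo --> a -> u k *m B @[k --> \oo] --> a *m B.
Proof.
move=> ua; apply: cvg_rV => j.
have E w : (w *m B) ord0 j = ip w (col j B)^T.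
  by rewrite mxE; apply: eq_bigr => i _; rewrite !mxE.
under eq_cvg do rewrite E; rewrite E.
by apply: cvg_ip => //; exact: cvg_cst.
Qed.

Lemma enorm_cauchy_cvg n (u : nat -> 'rV[R]_n) :
  (forall e, 0 < e -> exists N, forall i j, (N <= i)%N -> (N <= j)%N ->
    enorm (u i - u j) < e) -> cvg (u @ \oo).
Proof.
move=> h; apply/cauchy_cvgP/cauchy_ballP => e /[dup] e0 /h [N hN].
rewrite near_map2.
exists ([set k | (N <= k)%N], [set k | (N <= k)%N]) => /=.
  by split; exists N.
move=> [i j] /= [Ni Nj]; split=> // p q; rewrite (ord1 p) -ball_normE /=.
have := normr_coord_le (u i - u j) q; rewrite !mxE => /le_lt_trans; apply.
exact: hN.
Qed.

End Convergence.

(** * Subdifferentials: monotonicity, closed graph, optimality conditions *)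

Section Subdifferential.
Context {R : realType}.
Local Set Implicit Arguments.
Local Unset Strict Implicit.
Variables (n : nat) (f : 'rV[R]_n -> \bar R).

Lemma proper_fin y : proper_fun f -> (f y < +oo)%E -> f y \is a fin_num.
Proof. by move=> [fN _] fy; rewrite fin_numE fN lt_eqF. Qed.

Lemma subdiff_fine y phi u : subdiff f y phi -> f u \is a fin_num ->
  fine (f y) + ip phi (u - y) <= fine (f u).
Proof.
move=> [fy /(_ u)] + fu.
by rewrite -{1}(fineK fy) -{1}(fineK fu) -EFinD lee_fin.
Qed.

Lemma fine_subdiff y phi : proper_fun f -> f y \is a fin_num ->
  (forall u, f u \is a fin_num -> fine (f y) + ip phi (u - y) <= fine (f u)) ->
  subdiff f y phi.
Proof.
move=> pf fy h; split=> // u; have [fu|fu] := boolP (f u \is a fin_num).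
  by rewrite -(fineK fy) -(fineK fu) -EFinD lee_fin h.
move: fu; rewrite fin_numE (pf.1 u) /= negbK => /eqP ->; exact: leey.
Qed.

Lemma subdiff_monotone y z phi psi : subdiff f y phi -> subdiff f z psi ->
  0 <= ip (phi - psi) (y - z).
Proof.
move=> /[dup] h1 [fy _] /[dup] h2 [fz _].
have := subdiff_fine h1 fz; have := subdiff_fine h2 fy.
rewrite !ip_lin; lra.
Qed.

(** For each e > 0 the points [u k] eventually lie in the closed sublevel set of height [al + e],
    hence so does [ul]. *)
Lemma closed_fun_cvg_le (u : nat -> 'rV[R]_n) (a : nat -> R) (ul : 'rV[R]_n) (al : R) :
  closed_fun f -> u @ \oo --> ul -> a @ \oo --> al ->
  (forall k, (f (u k) <= (a k)%:E)%E) -> (f ul <= al%:E)%E.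
Proof.
move=> cf uu aa h; apply/lee_addgt0Pr => e e0; rewrite -EFinD.
apply: (closed_cvg _ (cf (al + e)) _ _ uu).
have /cvgrPdist_lt/(_ e e0) := aa; apply: filterS => k.
rewrite ltr_distlC => /andP[_ /ltW ak]; apply: le_trans (h k) _.
by rewrite lee_fin.
Qed.

(** For fixed v the subgradient inequality bounds [f (u k)] by a convergent real sequence, so lower
    semicontinuity passes to the limit. Properness supplies a v with finite value, which makes
    [f ul] finite. *)
Lemma subdiff_cvg (u phi : nat -> 'rV[R]_n) (ul phil : 'rV[R]_n) :
  proper_fun f -> closed_fun f -> (forall k, subdiff f (u k) (phi k)) ->
  u @ \oo --> ul -> phi @ \oo --> phil -> subdiff f ul phil.
Proof.
move=> pf cf sd uu pp.
have le v : f v \is a fin_num ->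
    (f ul <= (fine (f v) - ip phil (v - ul))%:E)%E.
  move=> fv; apply: (@closed_fun_cvg_le u
      (fun k => fine (f v) - ip (phi k) (v - u k))) => // [|k].
    apply: cvgB; first exact: cvg_cst.
    by apply: cvg_ip => //; apply: cvgB => //; exact: cvg_cst.
  have [fu _] := sd k; rewrite -(fineK fu) lee_fin.
  have := subdiff_fine (sd k) fv; lra.
have ful : f ul \is a fin_num.
  apply: proper_fin => //; have [_ [v /(proper_fin pf) fv]] := pf.
  exact: le_lt_trans (le v fv) (ltry _).
apply: fine_subdiff => // v fv; have := le v fv.
rewrite -{1}(fineK ful) lee_fin; lra.
Qed.

(* Compare the minimizer [s] with [s + t (u - s)] and let [t] tend to 0. *)
Lemma argmin_quad_subdiff p (B : 'M[R]_(n, p)) (d x : 'rV[R]_p) sigma s :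
  proper_fun f -> convex_fun f -> 0 <= sigma -> f s \is a fin_num ->
  (forall u, f u \is a fin_num ->
    fine (f s) + (ip x (s *m B + d) + sigma / 2 * enorm (s *m B + d) ^+ 2) <=
    fine (f u) + (ip x (u *m B + d) + sigma / 2 * enorm (u *m B + d) ^+ 2)) ->
  subdiff f s (- ((x + sigma *: (s *m B + d)) *m B^T)).
Proof.
move=> pf cf s0 fs h; apply: fine_subdiff => // u fu.
rewrite ipNl ip_adj trmxK mulmxBl ipC.
move: h; move Ea : (s *m B + d) => a h; move Ew : (u *m B - s *m B) => w.
set Q := ip w w; have Q0 : 0 <= Q by exact: ip_ge0.
suff key t : 0 < t -> t <= 1 ->
    fine (f s) - ip w (x + sigma *: a) <= fine (f u) + t * (sigma / 2 * Q).
  apply/ler_addgt0Pr => e e0.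
  (* The [+ 1] keeps the denominator positive even when [sigma / 2 * Q] vanishes; this [t] makes the
     error term at most [e]. *)
  pose t := Num.min 1 (e / (sigma / 2 * Q + 1)).
  have den : 0 < sigma / 2 * Q + 1 by rewrite ltr_wpDl// mulr_ge0// divr_ge0.
  have t0 : 0 < t by rewrite lt_min ltr01 divr_gt0.
  have t1 : t <= 1 by rewrite ge_min lexx.
  apply: le_trans (key t t0 t1) _; rewrite lerD2l.
  have : t <= e / (sigma / 2 * Q + 1) by rewrite ge_min lexx orbT.
  rewrite ler_pdivlMr//; lra.
move=> t0 t1.
have := cf u s t (ltW t0) t1.
rewrite -{1}(fineK fu) -{1}(fineK fs) -!EFinM -EFinD => cft.
set z := t *: u + (1 - t) *: s in cft.
have fz : f z \is a fin_num.
  by apply: proper_fin => //; exact: le_lt_trans cft (ltry _).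
move: cft (h z fz); rewrite -{1}(fineK fz) lee_fin.
have -> : z *m B + d = a + t *: w.
  rewrite /z -Ea -Ew mulmxDl -!scalemxAl; apply/rowP => i; rewrite !mxE; ring.
rewrite !enorm_sqr !ip_lin -/Q (ipC w a) (ipC w x) => h1 h2.
rewrite -(ler_pM2l t0); nra.
Qed.

End Subdifferential.

(** * Existence and stability of the proximal point *)

Section Prox.
Context {R : realType}.
Local Set Implicit Arguments.
Local Unset Strict Implicit.
Variables (n : nat) (f : 'rV[R]_n -> \bar R).
Hypothesis hf : pcc f.

(* The subgradient at [s] supplies the affine minorant that bounds the prox
   objective below; strong convexity then makes minimizing sequences Cauchy. *)
Lemma prox_argmin s phi (z : 'rV[R]_n) : subdiff f s phi -> exists u, forall v,
  (f u + (enorm (u - z) ^+ 2 / 2)%:E <= f v + (enorm (v - z) ^+ 2 / 2)%:E)%E.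
Proof.
have [pf cf lf] := hf => sd; have [fs _] := sd.
pose g v := fine (f v) + enorm (v - z) ^+ 2 / 2.
pose S := [set g v | v in [set v | f v \is a fin_num]].
have Slb : has_lbound S.
  (* Minimum over v of the affine minorant plus the quadratic, attained where phi + v - z = 0. *)
  exists (fine (f s) + ip phi (z - s) - ip phi phi / 2) => _ [v /= fv <-].
  have := subdiff_fine sd fv; have := ip_ge0 (phi + (v - z)).
  rewrite /g enorm_sqr !ip_lin (ipC z v) (ipC v phi) (ipC z phi); lra.
have Sinf : has_inf S by split=> //; exists (g s), s.
pose mu := inf S.
have mu_le v : f v \is a fin_num -> mu <= g v.
  by move=> fv; apply: ge_inf => //; exists v.
have /choice[u hu] : forall k, exists u,
    f u \is a fin_num /\ g u < mu + k.+1%:R^-1.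
  move=> k; have k0 : 0 < k.+1%:R^-1 :> R by rewrite invr_gt0.
  by have [_ [u fu <-] gu] := inf_adherent k0 Sinf; exists u.
(* At the midpoint w, g w <= (g (u i) + g (u j)) / 2 - |u i - u j|^2 / 8, while g w is at least
   [mu]. *)
have close i j : enorm (u i - u j) ^+ 2 <= 4 * (i.+1%:R^-1 + j.+1%:R^-1).
  have [fi gi] := hu i; have [fj gj] := hu j.
  have h0 : 0 <= 2^-1 :> R by [].
  have h1 : 2^-1 <= 1 :> R by rewrite invf_le1// ler1n.
  have := cf (u i) (u j) 2^-1 h0 h1.
  rewrite -{1}(fineK fi) -{1}(fineK fj) -!EFinM -EFinD.
  set w := 2^-1 *: u i + (1 - 2^-1) *: u j => cw.
  have fw : f w \is a fin_num.
    by apply: proper_fin => //; exact: le_lt_trans cw (ltry _).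
  have := mu_le w fw; move: cw gi gj; rewrite -{1}(fineK fw) lee_fin /g.
  have -> : w - z = 2^-1 *: (u i - z) + 2^-1 *: (u j - z).
    by apply/rowP => l; rewrite !mxE; field.
  have -> : u i - u j = (u i - z) - (u j - z) by rewrite opprB addrA subrK.
  move: (u i - z) (u j - z) (i.+1%:R^-1) (j.+1%:R^-1) => a b ei ej.
  rewrite !enorm_sqr !ip_lin (ipC b a); lra.
have /cvg_ex[/= ul ucv] : cvg (u @ \oo).
  apply: enorm_cauchy_cvg => e e0.
  (* Two terms below e^2 / 8, multiplied by the 4 in [close], stay below e^2. *)
  have e8 : 0 < e ^+ 2 / 8 by rewrite divr_gt0// exprn_gt0.
  have [N _ hN] := near_infty_natSinv_lt (PosNum e8).
  exists N => i j Ni Nj; rewrite -ltr_sqr ?nnegrE ?enorm_ge0 ?(ltW e0)//.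
  apply: le_lt_trans (close i j) _.
  have := hN i Ni; have := hN j Nj => /=.
  by move: (i.+1%:R^-1) (j.+1%:R^-1) => ei ej; lra.
have ful : (f ul <= (mu - enorm (ul - z) ^+ 2 / 2)%:E)%E.
  apply: (@closed_fun_cvg_le _ _ _ u
    (fun k => mu + k.+1%:R^-1 - enorm (u k - z) ^+ 2 / 2)) => // [|k].
    rewrite -[X in X - _]addr0; apply: cvgB.
      by apply: cvgD; [exact: cvg_cst | exact: cvg_harmonic].
    apply: cvgMl; under eq_cvg do rewrite enorm_sqr; rewrite enorm_sqr.
    by apply: cvg_ip; apply: cvgB => //; exact: cvg_cst.
  have [fk] := hu k; rewrite /g => gk; rewrite -(fineK fk) lee_fin.
  by move: (k.+1%:R^-1) gk => ek gk; lra.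
exists ul => v; apply: (@le_trans _ _ mu%:E).
  by rewrite (_ : mu = mu - enorm (ul - z) ^+ 2 / 2 + enorm (ul - z) ^+ 2 / 2);
    [rewrite EFinD leeD2r | rewrite subrK].
have [fv|fv] := boolP (f v \is a fin_num).
  by rewrite -(fineK fv) -EFinD lee_fin mu_le.
move: fv; rewrite fin_numE (pf.1 v) /= negbK => /eqP ->.
by rewrite addye// leey.
Qed.

(** The subgradient at [s] guarantees a minimizer, so [xget] does not return its default 0;
    first-order optimality follows. *)
Lemma subdiff_prox s phi (z : 'rV[R]_n) :
  subdiff f s phi -> subdiff f (prox f z) (z - prox f z).
Proof.
have [pf cf lf] := hf => sd; have [fs _] := sd.
have /(xgetPex 0) := prox_argmin z sd; rewrite -/(prox f z) /=.
move: (prox f z) => p hp.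
have fp : f p \is a fin_num.
  apply: proper_fin => //; have := hp s; rewrite -(fineK fs) -EFinD.
  by case: (f p) => [r _||_]; rewrite ?ltry ?ltNyr// addye// leye_eq.
(* The prox objective is the case of identity matrix, shift -z, zero multiplier and penalty 1. *)
have := @argmin_quad_subdiff _ _ f n 1%:M (- z) 0 1 p pf cf ler01 fp.
rewrite mulmx1 trmx1 mulmx1 add0r scale1r opprB; apply => u fu.
have := hp u; rewrite -{1}(fineK fp) -{1}(fineK fu) -!EFinD lee_fin mulmx1.
rewrite !ip0l; lra.
Qed.

(** Monotonicity between (s, phi) and (p, z - p), with p the proximal point, gives |s - p|^2 <= <s +
    phi - z, s - p>. This bounds KKT residuals by subgradient errors. *)
Lemma enorm_sub_prox s phi (z : 'rV[R]_n) :
  subdiff f s phi -> enorm (s - prox f z) <= enorm (s + phi - z).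
Proof.
move=> sd; have := subdiff_monotone sd (subdiff_prox z sd).
set p := prox f z; set a := s + phi - z.
have -> : phi - (z - p) = a - (s - p).
  by apply/rowP => i; rewrite !mxE; ring.
move: (s - p) => w; rewrite ipDl ipNl subr_ge0 -enorm_sqr => h.
have [->|w0] := eqVneq (enorm w) 0; first exact: enorm_ge0.
have wp : 0 < enorm w by rewrite lt_def w0 enorm_ge0.
by rewrite -(ler_pM2r wp) -expr2 (le_trans h)// ip_le_enorm.
Qed.

End Prox.

(** * Optimality conditions and firm nonexpansiveness for the two-block splitting *)

Section TwoBlock.
Context {R : realType}.
Local Set Implicit Arguments.
Local Unset Strict Implicit.
Variables (n : nat).

(** Lets [aug_lag_argmin] serve both the s-step and the y-step. *)
Lemma aug_lagC m p (f1 : 'rV[R]_m -> \bar R) (f2 : 'rV[R]_p -> \bar R)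
    (B1 : 'M[R]_(m, n)) (B2 : 'M[R]_(p, n)) c sigma y s x :
  aug_lag f1 f2 B1 B2 c sigma y s x = aug_lag f2 f1 B2 B1 c sigma s y x.
Proof. by rewrite /aug_lag (addeC (f1 y)) (addrC (y *m B1)). Qed.

Lemma aug_lag_argmin m p (f1 : 'rV[R]_m -> \bar R) (f2 : 'rV[R]_p -> \bar R)
    (B1 : 'M[R]_(m, n)) (B2 : 'M[R]_(p, n)) c sigma y s x :
  proper_fun f2 -> convex_fun f2 -> 0 <= sigma -> f1 y \is a fin_num ->
  (forall s', (aug_lag f1 f2 B1 B2 c sigma y s x <=
               aug_lag f1 f2 B1 B2 c sigma y s' x)%E) ->
  subdiff f2 s (- ((x + sigma *: (y *m B1 + s *m B2 - c)) *m B2^T)).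
Proof.
move=> pf cf s0 fy; rewrite /aug_lag -(fineK fy) => h.
(* Comparison with a point of dom f2 excludes an infinite value at the minimizer. *)
have fs : f2 s \is a fin_num.
  apply: proper_fin => //; have [_ [v /(proper_fin pf) fv]] := pf.
  have := h v; rewrite -(fineK fv) -!EFinD.
  by case: (f2 s) => [r _||_]; rewrite ?ltry ?ltNyr// addey// addye// leye_eq.
have E v : y *m B1 + v *m B2 - c = v *m B2 + (y *m B1 - c).
  by rewrite addrAC addrC.
rewrite E; apply: argmin_quad_subdiff => // u fu.
have := h u; rewrite -{1}(fineK fs) -{1}(fineK fu) -!EFinD lee_fin !E; lra.
Qed.

Variables (m p : nat) (f1 : 'rV[R]_m -> \bar R) (f2 : 'rV[R]_p -> \bar R).
Variables (B1 : 'M[R]_(m, n)) (B2 : 'M[R]_(p, n)) (c : 'rV[R]_n).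

Lemma subdiff_adj_monotone q (f : 'rV[R]_q -> \bar R) (B : 'M[R]_(q, n))
    u u' z z' :
  subdiff f u (- (z *m B^T)) -> subdiff f u' (- (z' *m B^T)) ->
  ip (z - z') ((u - u') *m B) <= 0.
Proof.
move=> h /(subdiff_monotone h).
by rewrite -opprD -mulNmx -mulmxDl ipNl oppr_ge0 ip_adj trmxK.
Qed.

(* With [e = xh - sigma B2 s], the step sends [e] to [e - 2 G] where
   [G = - sigma (B1 y + B2 s - c)]. *)
Lemma peaceman_rachford_firm (sigma : R) y s y' s' (xh x xh' x' : 'rV[R]_n) :
  0 <= sigma ->
  x = xh + sigma *: (y *m B1 + s *m B2 - c) ->
  x' = xh' + sigma *: (y' *m B1 + s' *m B2 - c) ->
  subdiff f1 y (- (x *m B1^T)) -> subdiff f2 s (- (xh *m B2^T)) ->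
  subdiff f1 y' (- (x' *m B1^T)) -> subdiff f2 s' (- (xh' *m B2^T)) ->
  forall G G' : 'rV[R]_n, G = - sigma *: (y *m B1 + s *m B2 - c) ->
  G' = - sigma *: (y' *m B1 + s' *m B2 - c) ->
  ip (G - G') (G - G') <=
  ip (G - G') ((xh - sigma *: (s *m B2)) - (xh' - sigma *: (s' *m B2))).
Proof.
move=> s0 xE xE' h1 h2 h1' h2' G G' GE GE'.
have := subdiff_adj_monotone h1 h1'; have := subdiff_adj_monotone h2 h2'.
have -> : x - x' = (xh - xh')
    + sigma *: ((y - y') *m B1 + (s - s') *m B2).
  by rewrite xE xE' !mulmxBl; apply/rowP => i; rewrite !mxE; ring.
have -> : G - G' = - sigma *: ((y - y') *m B1 + (s - s') *m B2).
  by rewrite GE GE' !mulmxBl; apply/rowP => i; rewrite !mxE; ring.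
have -> : (xh - sigma *: (s *m B2)) - (xh' - sigma *: (s' *m B2)) =
    (xh - xh') - sigma *: ((s - s') *m B2).
  by rewrite !mulmxBl; apply/rowP => i; rewrite !mxE; ring.
move: (xh - xh') ((y - y') *m B1) ((s - s') *m B2) => X u v.
rewrite !ip_lin (ipC u X) (ipC v X) (ipC v u) => h h'.
(* The gap between the two sides is exactly -sigma times the sum of the two monotonicity
   products. *)
have := mulr_ge0_le0 s0 (ler_wnDl h h'); lra.
Qed.

(** Finiteness of f1 at [y k] must be carried along: with an infinite value the s-step would compare
    only infinities. Each y-step restores it. *)
Lemma algorithmB_optimality (sigma : R) y s x xhat xhalf :
  pcc f1 -> pcc f2 -> 0 <= sigma -> (f1 (y 0%N) < +oo)%E ->
  algorithmB f1 f2 B1 B2 c sigma y s x xhat xhalf -> forall k,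
  subdiff f2 (s k.+1) (- (xhalf k *m B2^T)) /\
  subdiff f1 (y k.+1) (- (x k.+1 *m B1^T)).
Proof.
move=> [pf1 cf1 _] [pf2 cf2 _] s0 fy0 [_ [As Eh Ay Ex _]].
have step k : f1 (y k) \is a fin_num ->
    subdiff f2 (s k.+1) (- (xhalf k *m B2^T)) /\
    subdiff f1 (y k.+1) (- (x k.+1 *m B1^T)).
  move=> fy; have h2 : subdiff f2 (s k.+1) (- (xhalf k *m B2^T)).
    by rewrite Eh; apply: aug_lag_argmin (As k).
  split=> //; rewrite Ex (addrC (y k.+1 *m B1)); have [fs _] := h2.
  apply: (@aug_lag_argmin _ _ f2 f1) => // y'.
  by rewrite -!(aug_lagC f1 f2).
elim=> [|k [_ [fy _]]]; apply: step => //.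
exact: proper_fin.
Qed.

Lemma algorithmB_limit_optimality (sigma : R)
    y s x xhat xhalf (ystar : 'rV[R]_m) (sstar : 'rV[R]_p) (xstar : 'rV[R]_n) :
  pcc f1 -> pcc f2 -> 0 <= sigma -> (f1 (y 0%N) < +oo)%E ->
  algorithmB f1 f2 B1 B2 c sigma y s x xhat xhalf ->
  y @ \oo --> ystar -> s @ \oo --> sstar -> x @ \oo --> xstar ->
  ystar *m B1 + sstar *m B2 = c ->
  subdiff f2 sstar (- (xstar *m B2^T)) /\ subdiff f1 ystar (- (xstar *m B1^T)).
Proof.
move=> hf1 hf2 s0 fy0 halg yc sc xc feas.
have opt := algorithmB_optimality hf1 hf2 s0 fy0 halg.
have [_ [_ _ _ Ex _]] := halg.
(* Shifted sequences, because optimality holds only from index 1 on. *)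
have yS : y k.+1 @[k --> \oo] --> ystar by rewrite (cvg_shiftS y).
have sS : s k.+1 @[k --> \oo] --> sstar by rewrite (cvg_shiftS s).
have xS : x k.+1 @[k --> \oo] --> xstar by rewrite (cvg_shiftS x).
(* [xhalf] and [x] differ by sigma times the residual, which vanishes in the limit by
   feasibility. *)
have hS : xhalf k @[k --> \oo] --> xstar.
  have E k : xhalf k = x k.+1 - sigma *: (y k.+1 *m B1 + s k.+1 *m B2 - c).
    by rewrite Ex addrK.
  under eq_cvg do rewrite E.
  rewrite -[xstar]subr0 -(scaler0 _ sigma) -(subrr c) -{1}feas.
  apply: cvgB => //; apply: cvgZr; apply: cvgB; last exact: cvg_cst.
  by apply: cvgD; exact: cvg_mulmxr.
have [[pf1 _ cf1] [pf2 _ cf2]] := (hf1, hf2).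
split.
- apply: (subdiff_cvg pf2 cf2 (fun k => (opt k).1) sS).
  by apply: cvgN; exact: cvg_mulmxr.
- apply: (subdiff_cvg pf1 cf1 (fun k => (opt k).2) yS).
  by apply: cvgN; exact: cvg_mulmxr.
Qed.

End TwoBlock.

(** * Assembly of the three rates *)

Theorem theorem3p6 (R : realType) (n m p : nat)
  (f1 : 'rV[R]_m -> \bar R) (f2 : 'rV[R]_p -> \bar R)
  (B1 : 'M[R]_(m, n)) (B2 : 'M[R]_(p, n)) (c : 'rV[R]_n)
  (Sig1 : 'M[R]_m) (Sig2 : 'M[R]_p)
  (hf1 : pcc f1) (hf2 : pcc f2)
  (hS1 : sigma_op f1 Sig1) (hS2 : sigma_op f2 Sig2)
  (hA1 : assumption1 f1 f2 B1 B2 c)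
  (hA2 : posdef (Sig1 + B1 *m B1^T) /\ posdef (Sig2 + B2 *m B2^T))
  (sigma : R) (hsigma : 0 < sigma)
  (y : nat -> 'rV[R]_m) (s : nat -> 'rV[R]_p) (x xhat xhalf : nat -> 'rV[R]_n)
  (hy0 : (f1 (y 0%N) < +oo)%E)
  (halg : algorithmB f1 f2 B1 B2 c sigma y s x xhat xhalf)
  (ystar : 'rV[R]_m) (sstar : 'rV[R]_p) (xstar : 'rV[R]_n)
  (hy : y @ \oo --> ystar) (hs : s @ \oo --> sstar) (hx : x @ \oo --> xstar)
  (hP : solves_P f1 f2 B1 B2 c ystar sstar)
  (hD : solves_D f1 f2 B1 B2 c xstar) :
  let D0 := enorm (x 0%N - xstar) + sigma * enorm (y 0%N *m B1 - ystar *m B1) in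
  forall k : nat,
  [/\ kkt_res_norm f1 f2 B1 B2 c (y k.+1) (s k.+1) (x k.+1)
        <= (k.+1%:R)^-1 * ((sigma * opnorm B2^T + 1) / sigma * D0),
      (hgap f1 f2 ystar sstar (y k.+1) (s k.+1)
        >= - ((k.+1%:R)^-1 * (enorm xstar / sigma * D0))%:E)%E &
      (hgap f1 f2 ystar sstar (y k.+1) (s k.+1)
        <= ((k.+1%:R)^-1 * ((D0 ^+ 2 + enorm xstar * D0) / sigma))%:E)%E].
Proof.
move=> D0 k; have s0 := ltW hsigma; have sN0 := lt0r_neq0 hsigma.
have [feas _ _] := hP.
have opt := algorithmB_optimality hf1 hf2 s0 hy0 halg.
have [opt2 opt1] := algorithmB_limit_optimality hf1 hf2 s0 hy0 halg hy hs hx feas.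
have [xhat0 [_ Eh _ Ex Exhat]] := halg.
(* Index k of [r], [e], [G] belongs to the step producing iterate k+1, whence the factor 1/(k+1). *)
pose r k := y k.+1 *m B1 + s k.+1 *m B2 - c.
pose e k := xhalf k - sigma *: (s k.+1 *m B2).
pose G k := - sigma *: r k.
pose es := xstar - sigma *: (sstar *m B2).
have eE j : e j = xhat j + sigma *: (y j *m B1 - c).
  by rewrite /e Eh; apply/rowP => i; rewrite !mxE; ring.
(* The correction term in [xhat] turns its averaging into averaging of [e], since e j - 2 G j = x
   j.+1 + sigma (B1 y j.+1 - c). *)
have rec j : e j.+1 = (j.+2%:R)^-1 *: e 0%N
    + (j.+1%:R / j.+2%:R) *: (e j - 2 *: G j).
  rewrite (eE j.+1) (eE 0%N) Exhat Ex /e /G /r; apply/rowP => i; rewrite !mxE.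
  by field; rewrite -(natrD _ 2) pnatr_eq0.
have firm j : ip (G j.+1 - G j) (G j.+1 - G j) <=
    ip (G j.+1 - G j) (e j.+1 - e j).
  exact: (peaceman_rachford_firm s0 (Ex j.+1) (Ex j)
    (opt j.+1).2 (opt j.+1).1 (opt j).2 (opt j).1 erefl erefl).
(* The limit is treated as a step with zero residual, so its G vanishes. *)
have Estar : xstar = xstar + sigma *: (ystar *m B1 + sstar *m B2 - c).
  by rewrite feas subrr scaler0 addr0.
have firm_fix j : ip (G j) (G j) <= ip (G j) (e j - es).
  have := peaceman_rachford_firm s0 (Ex j) Estar
    (opt j).2 (opt j).1 opt1 opt2 erefl erefl.
  by rewrite feas subrr scaler0 subr0.
have e0D : enorm (e 0%N - es) <= D0.
  rewrite (_ : e 0%N - es =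
      (x 0%N - xstar) + sigma *: (y 0%N *m B1 - ystar *m B1)).
    by rewrite (le_trans (enormD _ _))// enormZ ger0_norm.
  by rewrite eE xhat0 /es -feas; apply/rowP => i; rewrite !mxE; ring.
have k1 : 0 < k.+1%:R :> R by [].
have D0_ge0 : 0 <= D0 by apply: le_trans e0D; exact: enorm_ge0.
have rD : sigma * enorm (r k) <= (k.+1%:R)^-1 * D0.
  rewrite mulrC ler_pdivlMl//; apply: le_trans e0D.
  apply: le_trans (halpern_residual rec firm firm_fix k).
  by rewrite /G enormZ normrN (ger0_norm s0) mulrC (mulrC sigma).
have eD : enorm (e k - es) <= D0 by apply: le_trans (halpern_bounded rec firm_fix k) e0D.
have [sd2 sd1] := opt k; have [[fy _] [fs _]] := (sd1, sd2).
have [[fys _] [fss _]] := (opt1, opt2).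
have rE : r k = (y k.+1 - ystar) *m B1 + (s k.+1 - sstar) *m B2.
  by rewrite /r -feas !mulmxBl; apply/rowP => i; rewrite !mxE; ring.
have hE : hgap f1 f2 ystar sstar (y k.+1) (s k.+1) = (fine (f1 (y k.+1))
    + fine (f2 (s k.+1)) - fine (f1 ystar) - fine (f2 sstar))%:E.
  rewrite /hgap -(fineK fy) -(fineK fs) -(fineK fys) -(fineK fss).
  by [].
have xr : `|ip xstar (r k)| <= (k.+1%:R)^-1 * (enorm xstar / sigma * D0).
  rewrite [leRHS](_ : _ = enorm xstar * ((k.+1%:R)^-1 * D0 / sigma)); last first.
    by field; rewrite sN0 -(natrD _ 1) pnatr_eq0.
  apply: le_trans (_ : enorm xstar * enorm (r k) <= _).
    rewrite ler_norml ip_le_enorm andbT lerNl -ipNl -(enormN xstar).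
    exact: ip_le_enorm.
  by rewrite ler_wpM2l ?enorm_ge0// ler_pdivlMr// mulrC.
split; last 2 first.
(* Lower bound: subgradients at the limit give h >= -<xstar, r>. *)
- rewrite hE lee_fin; move: xr; rewrite ler_norml => /andP[_ xr].
  have := subdiff_fine opt1 fy; have := subdiff_fine opt2 fs.
  rewrite !ipNl !ip_adj !trmxK; move: xr; rewrite rE ipDr.
  by move: (_ * (_ / sigma * D0)) => K; lra.
(* Upper bound: subgradients at the iterate give h <= -<r, e - es> - <xstar, r> - sigma |r|^2. *)
- rewrite hE lee_fin; move: xr; rewrite ler_norml => /andP[xr _].
  have := subdiff_fine sd1 fys; have := subdiff_fine sd2 fss.
  have rev q (a b : 'rV[R]_q) (B : 'M[R]_(q, n)) :
    (b - a) *m B = - ((a - b) *m B) by rewrite -mulNmx opprB.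
  rewrite !ipNl !ip_adj !trmxK !(rev _ (y k.+1)) !(rev _ (s k.+1)) !ipNr !opprK.
  have : - ip (r k) (e k - es) <= (k.+1%:R)^-1 * (D0 ^+ 2 / sigma).
    rewrite -ipNl (le_trans (ip_le_enorm _ _))// enormN.
    rewrite [leRHS](_ : _ = (k.+1%:R)^-1 * D0 / sigma * D0); last first.
      by field; rewrite sN0 -(natrD _ 1) pnatr_eq0.
    by rewrite ler_pM ?enorm_ge0// ler_pdivlMr// mulrC.
  have -> : e k - es = xhalf k - xstar - sigma *: ((s k.+1 - sstar) *m B2).
    by rewrite /e /es mulmxBl; apply/rowP => i; rewrite !mxE; ring.
  rewrite Ex -/(r k) [_ * ((_ + _) / sigma)](_ : _ =
    (k.+1%:R)^-1 * (D0 ^+ 2 / sigma)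
    + (k.+1%:R)^-1 * (enorm xstar / sigma * D0)); last first.
    by field; rewrite sN0 -(natrD _ 1) pnatr_eq0.
  have := mulr_ge0 s0 (ip_ge0 (r k)); move: xr; rewrite rE.
  move: ((y k.+1 - ystar) *m B1) ((s k.+1 - sstar) *m B2) (xhalf k) => u v xh.
  move: (_ * (D0 ^+ 2 / _)) (_ * (_ / sigma * D0)) => K1 K2.
  rewrite !ip_lin (ipC u xh) (ipC u xstar) (ipC v xh) (ipC v xstar) (ipC v u).
  lra.
(* The y-component of the KKT residual is zero, as -B1^* x is an exact subgradient at y. *)
- have p1 : enorm (y k.+1 - prox f1 (y k.+1 - x k.+1 *m B1^T)) = 0.
    apply/eqP; rewrite eq_le enorm_ge0 andbT.
    rewrite (le_trans (enorm_sub_prox hf1 _ sd1))//.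
    by rewrite opprB addrA subrK subrr enorm0.
  (* The subgradient at s uses [xhalf k] instead of [x k.+1]; the mismatch is sigma B2^* r. *)
  have p2 : enorm (s k.+1 - prox f2 (s k.+1 - x k.+1 *m B2^T)) <=
      opnorm B2^T * (sigma * enorm (r k)).
    apply: le_trans (enorm_sub_prox hf2 _ sd2) _.
    rewrite (_ : _ - _ = (sigma *: r k) *m B2^T); last first.
      by rewrite /r Ex !mulmxDl; apply/rowP => i; rewrite !mxE; ring.
    by rewrite (le_trans (opnorm_le _ _))// enormZ ger0_norm.
  have p3 : enorm (c - y k.+1 *m B1 - s k.+1 *m B2) = enorm (r k).
    by rewrite -enormN /r; congr enorm; apply/rowP => i; rewrite !mxE; ring.
  rewrite /kkt_res_norm p1 p3 expr0n /= add0r.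
  move: p2; set b := enorm (s k.+1 - _); set N := opnorm B2^T => p2.
  have b0 : 0 <= b := enorm_ge0 _; have r0 := enorm_ge0 (r k).
  apply: (@le_trans _ _ (b + enorm (r k))).
    rewrite -(@ger0_norm _ (b + _)) ?addr_ge0// -sqrtr_sqr ler_wsqrtr//.
    by have := mulr_ge0 b0 r0; lra.
  have N0 : 0 <= N by exact: opnorm_ge0.
  rewrite [leRHS](_ : _ = (sigma * N + 1) / sigma * ((k.+1%:R)^-1 * D0)); last first.
    by field; rewrite sN0 -(natrD _ 1) pnatr_eq0.
  apply: (@le_trans _ _ ((sigma * N + 1) / sigma * (sigma * enorm (r k)))).
    rewrite mulrA divfK//; lra.
  by rewrite ler_wpM2l// divr_ge0// addr_ge0// mulr_ge0.
Qed.
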